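(* Let $p$ be an odd prime and let $G$ be a finite $p$-group of nilpotency class $c\neq 1$. Let $n=\lceil \log_{p-1} c\rceil$. Then $\exp(G\wedge G)$ divides $\exp(G)^n$. In particular, $\exp(M(G))$ divides $\exp(G)^n$.
   Context: Conventions: ${}^g h = ghg^{-1}$, $[g,h]=ghg^{-1}h^{-1}$. The nonabelian tensor square $G\otimes G$ is generated by symbols $g\otimes h$ subject to $gg'\otimes h=({}^g g'\otimes {}^g h)(g\otimes h)$ and $g\otimes hh'=(g\otimes h)({}^h g\otimes {}^h h')$; the exterior square $G\wedge G$ is its quotient by the subgroup generated by all $x\otimes x$. $M(G)$ is the kernel of $G\wedge G\to[G,G]$, $g\wedge h\mapsto[g,h]$, isomorphic to $H_2(G,\mathbb{Z})$. *)

(* Defs.v *)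
From mathcomp Require Import all_boot all_fingroup all_solvable.
Set Implicit Arguments. Unset Strict Implicit. Unset Printing Implicit Defensive.
Import GroupScope.

(* The nonabelian exterior square G /\ G, given by its presentation.
   Paper conventions: ^g h = g h g^-1 and [g,h] = g h g^-1 h^-1.
   In MathComp, x ^ y = y^-1 x y, hence ^g h = h ^ g^-1.

   A letter (false, (g, h)) stands for the generator g /\ h,
   and (true, (g, h)) for its inverse (g /\ h)^-1.  Elements of the
   free group on the symbols are words; G /\ G is the quotient of the
   set of words (letters with entries in G) by the congruence [ext_rel G]
   generated by free cancellation and the defining relations. *)

Section ExteriorSquare.
Variable gT : finGroupType.

Definition ext_letter := (bool * (gT * gT))%type.
Definition ext_word := seq ext_letter.

Definition ext_word_in (G : {set gT}) (w : ext_word) : bool :=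
  all (fun l : ext_letter => (l.2.1 \in G) && (l.2.2 \in G)) w.

Inductive ext_rel (G : {set gT}) : ext_word -> ext_word -> Prop :=
| ext_refl w : ext_rel G w w
| ext_sym u v : ext_rel G u v -> ext_rel G v u
| ext_trans u v w : ext_rel G u v -> ext_rel G v w -> ext_rel G u w
| ext_cong a u v b : ext_rel G u v -> ext_rel G (a ++ u ++ b) (a ++ v ++ b)
| ext_cancel (b : bool) (x : gT * gT) :
    ext_rel G [:: (b, x); (~~ b, x)] [::]
| ext_mull g g' h : g \in G -> g' \in G -> h \in G ->
    ext_rel G [:: (false, (g * g', h))]
              [:: (false, (g' ^ g^-1, h ^ g^-1)); (false, (g, h))]
| ext_mulr g h h' : g \in G -> h \in G -> h' \in G ->
    ext_rel G [:: (false, (g, h * h'))]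
              [:: (false, (g, h)); (false, (g ^ h^-1, h' ^ h^-1))]
| ext_diag g : g \in G -> ext_rel G [:: (false, (g, g))] [::].

Definition ext_pow (w : ext_word) (N : nat) : ext_word := flatten (nseq N w).

Definition ext_exponent_dvd (G : {set gT}) (N : nat) : Prop :=
  forall w, ext_word_in G w -> ext_rel G (ext_pow w N) [::].

Definition pcomm (g h : gT) : gT := g * h * g^-1 * h^-1.

Definition ext_eval (w : ext_word) : gT :=
  foldr (fun (l : ext_letter) acc =>
           (if l.1 then (pcomm l.2.1 l.2.2)^-1 else pcomm l.2.1 l.2.2) * acc)
        1 w.

(* exp(M(G)) divides N, where M(G) = ker (G /\ G -> [G,G]) *)
Definition schur_exponent_dvd (G : {set gT}) (N : nat) : Prop :=
  forall w, ext_word_in G w -> ext_eval w = 1 -> ext_rel G (ext_pow w N) [::].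

End ExteriorSquare.

(* Main.v *)
(* Write q = exponent G.  In the semidirect product W of G /\ G by G, let F_i be
   generated by the i-th term L_i of the lower central series of G together with
   all x /\ y, x in L_(i-1); then [F_i, F_k] <= F_(i+k).  Expanding (x ^ q) /\ y
   shows that t = x /\ y satisfies (x^-1 t) ^ q = 1 in W, so t is a product of two
   elements x and x^-1 t killed by q.  As in a regular p-group, modulo the p-th
   term of a filtration a product of two elements killed by q is killed by q.
   For x in L_s, the filtration with first term <x> F_(s+1) and i-th term
   F_(is+1) thus gives t ^ q in F_(ps+1), and then the same for every product of
   such t.  Iterating from s = 1, the q^n-th powers of elements of G /\ G lie in
   F_(p^n+1), which is trivial as soon as p^n exceeds the class c; this holds
   when c <= (p-1)^n and c <> 1.

   Regularity follows from the Hall-Petrescu formula, obtained here by Taylor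
   expansion of the polynomial sequence y^-n x^-n (x y)^n: its values at q are
   products of a_k ^ 'C(q, k) with a_k in the k-th term and 2 <= k < p. *)
Require Import Defs.
From HB Require Import structures.
From mathcomp Require Import all_boot all_fingroup all_solvable.
From mathcomp Require Import generic_quotient zify.
From mathcomp Require boolp.
Set Implicit Arguments. Unset Strict Implicit. Unset Printing Implicit Defensive.
Import GroupScope.
Local Open Scope quotient_scope.

(** * Filtrations and polynomial sequences *)

Section CommutatorIdentities.
Variable T : groupType.
Implicit Types x y z : T.

Lemma commg_mull x y z : [~ x * y, z] = [~ x, z] ^ y * [~ y, z].
Proof. by rewrite /commg /conjg !gnorm. Qed.

Lemma commg_mulr x y z : [~ x, y * z] = [~ x, z] * [~ x, y] ^ z.
Proof. by rewrite /commg /conjg !gnorm. Qed.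

Lemma commg_invl x y : [~ x^-1, y] = ([~ x, y]^-1) ^ x^-1.
Proof. by rewrite /commg /conjg !gnorm. Qed.

(** Every factor on the right is, up to conjugation, a commutator involving [a] or [b]. It therefore
    lies one step deeper than [[~ x, y]] when [a] and [b] lie one step deeper than [x] and [y]. *)
Lemma commg_divE x y a b :
  [~ x, y]^-1 * [~ x * a, y * b] =
  ([~ x, b] ^ a) ^ [~ x, y] * [~ [~ x, y], b * a] * [~ a, b] * [~ a, y] ^ b.
Proof. by rewrite /commg /conjg !gnorm. Qed.

End CommutatorIdentities.

Section Filtration.

(** Terms are predicates because [T] need not be finite. The case [j = 0] of [filtR] makes [F 0]
    normalise every term. *)
Record filtration (T : groupType) (F : nat -> T -> Prop) : Prop := Filtration {
  filt1 : forall i, F i 1;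
  filtM : forall i x y, F i x -> F i y -> F i (x * y);
  filtV : forall i x, F i x -> F i x^-1;
  filtS : forall i x, F i.+1 x -> F i x;
  filtR : forall i j x y, F i x -> F j y -> F (i + j) [~ x, y] }.

Section Basics.
Variables (T : groupType) (F : nat -> T -> Prop).
Hypothesis fF : filtration F.

Lemma filt_le i j x : i <= j -> F j x -> F i x.
Proof.
move/subnK <-; elim: (j - i) => // k IH; rewrite addSn => /(filtS fF); exact: IH.
Qed.

Lemma filtX i x n : F i x -> F i (x ^+ n).
Proof.
move=> Fx; elim: n => [|n IH]; first by rewrite expg0; apply: filt1.
by rewrite expgS; apply: filtM.
Qed.

Lemma filtJ i x y : F i x -> F 0 y -> F i (x ^ y).
Proof.
move=> Fx Fy; rewrite -[x ^ y](mulKg x^-1) invgK -commgEl.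
by apply: filtM => //; rewrite -[i]addn0; apply: (filtR fF).
Qed.

Lemma filt_reindex (phi : nat -> nat) :
    (forall i, phi i <= phi i.+1) ->
    (forall i j, phi (i + j) <= phi i + phi j) ->
  filtration (F \o phi).
Proof.
move=> phiS phiD; split=> /=.
- by move=> i; apply: filt1.
- by move=> i; apply: filtM.
- by move=> i; apply: filtV.
- by move=> i x; apply: filt_le.
by move=> i j x y Fx Fy; apply: (filt_le (phiD i j)); apply: (filtR fF).
Qed.

(** A graded form of the edge group of Host and Kra: through it, one application of [diff] becomes
    membership of a pair. *)
Definition filt_square i (u : T * T) := F i u.1 /\ F i.+1 (u.1^-1 * u.2).

Lemma filt_squareE i u : filt_square i u ->
  F i u.1 /\ exists2 a, F i.+1 a & u.2 = u.1 * a.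
Proof. by case=> F1 F2; split=> //; exists (u.1^-1 * u.2); rewrite ?mulKVg ?mulVKg. Qed.

Lemma filt_0 i x : F i x -> F 0 x. Proof. exact: filt_le. Qed.

Lemma filt_square_filtration : filtration filt_square.
Proof.
split.
- by move=> i; split=> /=; rewrite ?mulVg; apply: filt1.
- move=> i u v /filt_squareE [Fu [a Fa Ea]] /filt_squareE [Fv [b Fb Eb]].
  split=> /=; first exact: filtM.
  rewrite Ea Eb; have ->: (u.1 * v.1)^-1 * (u.1 * a * (v.1 * b)) = a ^ v.1 * b.
    by rewrite /conjg !gnorm.
  by apply: filtM => //; apply: filtJ => //; apply: filt_0 Fv.
- move=> i u /filt_squareE [Fu [a Fa Ea]]; split=> /=; first exact: filtV.
  rewrite Ea; have ->: u.1^-1^-1 * (u.1 * a)^-1 = (a^-1) ^ u.1^-1.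
    by rewrite /conjg !gnorm.
  by apply: filtJ; apply: filtV => //; apply: filt_0 Fu.
- by move=> i u [F1 F2]; split; apply: filtS.
move=> i j u v /filt_squareE [Fu [a Fa Ea]] /filt_squareE [Fv [b Fb Eb]].
split; first exact: (filtR fF Fu Fv).
change (F (i + j).+1 ([~ u.1, v.1]^-1 * [~ u.2, v.2])).
have Fw := filtR fF Fu Fv.
rewrite Ea Eb commg_divE; apply: (filtM fF); first apply: (filtM fF); first apply: (filtM fF).
- apply: filtJ; last exact: filt_0 Fw.
  apply: filtJ; last exact: filt_0 Fa.
  by rewrite -addnS; apply: (filtR fF).
- rewrite -addn1; apply: (filtR fF) => //.
  by apply: filtM => //; [apply: filt_le Fb | apply: filt_le Fa].
- by apply: (@filt_le _ (i.+1 + j.+1)); [rewrite addnS addSn | apply: (filtR fF)].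
apply: filtJ; last exact: filt_0 Fb.
by rewrite -addSn; apply: (filtR fF).
Qed.

End Basics.

Definition diff (T : groupType) (g : nat -> T) n := (g n)^-1 * g n.+1.

(** Leibman's polynomial sequences, tested only up to order [k] so that [k] can serve as induction
    variable. *)
Definition polyseq (T : groupType) (F : nat -> T -> Prop) k (g : nat -> T) :=
  forall j n, j <= k -> F j (iter j (@diff T) g n).

Lemma diff_square (T : groupType) (g : nat -> T) j n :
  iter j (@diff _) (fun n => (g n, g n.+1) : T * T) n =
  (iter j (@diff _) g n, iter j (@diff _) g n.+1).
Proof. by elim: j n => // j IH n; rewrite !iterS /diff !IH. Qed.

Lemma polyseq_square (T : groupType) (F : nat -> T -> Prop) k g :
    filtration F ->
  polyseq F k.+1 g <->
  polyseq (filt_square F) k (fun n => (g n, g n.+1) : T * T).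
Proof.
move=> fF; split=> Pg j n lejk.
  rewrite diff_square; split=> /=; first by apply: Pg; apply: leqW.
  by have:= Pg j.+1 n lejk; rewrite iterS.
case: j lejk => [|j] lejk; first by have [] := Pg 0 n isT.
by have [_] := Pg j n lejk; rewrite diff_square.
Qed.

(* A polynomial sequence of degree k.+1 for F is one of degree k for the
   filtration of pairs, so closure reduces to degree 0, where it is clear. *)
Lemma polyseqM (T : groupType) (F : nat -> T -> Prop) k g h :
    filtration F -> polyseq F k g -> polyseq F k h ->
  polyseq F k (fun n => g n * h n).
Proof.
elim: k T F g h => [|k IH] T F g h fF.
  move=> Pg Ph j n; rewrite leqn0 => /eqP->.
  by apply: filtM => //; [apply: (Pg 0) | apply: (Ph 0)].
move=> /(polyseq_square _ _ fF) Pg /(polyseq_square _ _ fF) Ph.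
apply/(polyseq_square _ _ fF).
exact: (IH _ _ _ _ (filt_square_filtration fF) Pg Ph).
Qed.

Section Taylor.
Variables (T : groupType) (F : nat -> T -> Prop).
Hypothesis fF : filtration F.

Lemma eq_diff (g h : nat -> T) : g =1 h -> diff g =1 diff h.
Proof. by move=> eq_gh n; rewrite /diff !eq_gh. Qed.

Lemma eq_iter_diff j (g h : nat -> T) :
  g =1 h -> iter j (@diff T) g =1 iter j (@diff T) h.
Proof. by move=> eq_gh; elim: j => // j IH; apply: eq_diff. Qed.

Lemma iter_diff1 j n : iter j (@diff T) (fun=> 1) n = 1.
Proof. by elim: j n => // j IH n; rewrite iterS /diff !IH mulVg. Qed.

(** By Pascal's rule each difference lowers [m] by one, so the [j]-th difference is
    [a ^+ 'C(n, m - j)], and it is trivial once [j > m]. *)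
Lemma polyseq_bin k m (a : T) : F m a -> polyseq F k (fun n => a ^+ 'C(n, m)).
Proof.
move=> Fa j n _.
have [i Fi ->]: exists2 i, F j (a ^+ i) &
    iter j (@diff T) (fun n => a ^+ 'C(n, m)) n = a ^+ i; last by [].
have [lejm | ltmj] := leqP j m; last first.
  exists 0; first exact: filt1.
  rewrite -(subnK ltmj) iterD.
  suff E: iter m.+1 (@diff T) (fun n => a ^+ 'C(n, m)) =1 fun=> 1.
    by rewrite (eq_iter_diff _ E) iter_diff1.
  elim: m {Fa ltmj} => [|m IH] i.
    by rewrite /= /diff !bin0 mulVg.
  rewrite iterSr -[RHS](IH i); apply: eq_iter_diff => {}i.
  by rewrite /diff binS expgnDr mulKg.
exists 'C(n, m - j); first by apply: filtX => //; apply: filt_le Fa.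
elim: j m lejm {Fa} n => [|j IH] m lejm n; first by rewrite subn0.
case: m lejm => // m lejm; rewrite iterSr subSS -IH //.
by apply: eq_iter_diff => {}n; rewrite /diff binS expgnDr mulKg.
Qed.

Lemma iter_diff_lead m (g : nat -> T) :
  (forall k, k < m -> g k = 1) -> iter m (@diff T) g 0 = g m.
Proof.
elim: m g => // m IH g g1; rewrite iterSr IH => [|k ltkm].
  by rewrite /diff g1 // invg1 mul1g.
by rewrite /diff !g1 ?mulVg // ltnS ltnW.
Qed.

(** Summation undoes the differences one at a time, since the initial values are trivial. *)
Lemma diff_integral i m (g : nat -> T) :
    (forall k, k < m -> g k = 1) -> (forall n, F i (iter m (@diff T) g n)) ->
  forall n, F i (g n).
Proof.
elim: m g => // m IH g g1 Fg.
have{Fg IH} Fd: forall n, F i (diff g n).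
  apply: IH => [k ltkm|n]; last by have:= Fg n; rewrite iterSr.
  by rewrite /diff !g1 ?mulVg // ltnS ltnW.
elim=> [|n IHn]; first by rewrite (g1 0) //; exact: filt1 fF _.
by rewrite -(mulVKg (g n) (g n.+1)); apply: (filtM fF) => //; apply: Fd.
Qed.

(** Taylor expansion. The value [a = g m] is the [m]-th difference at 0, hence lies in [F m], and
    multiplication by [a^-1 ^+ 'C(n, m)] makes the value at [m] trivial too. Once all values before
    [c] are trivial, [diff_integral] concludes from the [c]-th difference. *)
Lemma polyseq_eval c q m (g : nat -> T) :
    polyseq F c g -> (forall k, k < m -> g k = 1) ->
    (forall k a, m <= k < c -> F k a -> F c (a ^+ 'C(q, k))) ->
  F c (g q).
Proof.
have [lecm|ltmc] := leqP c m.
  move=> Pg g1 _; apply: (@diff_integral _ c) => [k ltkc|n]; last exact: Pg.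
  by apply: g1; apply: leq_trans lecm.
move: {2}(c - m) (erefl (c - m)) => d Ed.
elim: d m Ed ltmc g => [|d IH] m Ed ltmc g Pg g1 Fbin.
  by move: ltmc; rewrite -subn_gt0 Ed.
set a := g m; have Fa: F m a.
  by rewrite /a -iter_diff_lead //; apply: Pg; apply: ltnW.
pose h n := a^-1 ^+ 'C(n, m) * g n.
have Ph: polyseq F c h by apply: (polyseqM fF) => //; apply: polyseq_bin; apply: (filtV fF).
have h1 k: k < m.+1 -> h k = 1.
  rewrite ltnS leq_eqVlt /h => /predU1P[->|ltkm]; first by rewrite binn expg1 mulVg.
  by rewrite bin_small // g1 // mulg1.
have Fh: F c (h q).
  have [ltSmc|] := ltnP m.+1 c; last first.
    move=> leSmc; apply: (@diff_integral _ c) => [k ltkc|n]; last exact: Ph.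
    by apply: h1; apply: leq_trans leSmc.
  apply: (IH m.+1) => //; first by rewrite subnS Ed.
  by move=> k b /andP[ltmk ltkc]; apply: Fbin; rewrite (ltnW ltmk).
have ->: g q = a ^+ 'C(q, m) * h q by rewrite /h mulgA expVgn mulgV mul1g.
by apply: filtM => //; apply: Fbin; rewrite ?leqnn.
Qed.

End Taylor.

End Filtration.

(** * Regularity *)

Section Adjoin.
Variables (T : groupType) (F : nat -> T -> Prop).
Hypothesis fF : filtration F.
Variables (m : nat) (x : T).
Hypothesis Fx : F m x.

(* Plays the role of the subgroup <x> F_(m+1): it contains x and F_(m+1) and is
   abelian modulo F_(2m+1), and no integer powers of x are needed. *)
Definition bicent z :=
  F m z /\ forall u, F m u -> F (2 * m).+1 [~ x, u] -> F (2 * m).+1 [~ z, u].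

(** Indices 0 and 1 share a term, as [expgM_filt] demands of its filtration. *)
Definition filt_adjoin i := if i <= 1 then bicent else F (i * m).+1.

Lemma bicent_sub z : F m.+1 z -> bicent z.
Proof.
move=> Fz; split=> [|u Fu _]; first exact: filtS Fz.
by rewrite mul2n -addnn -addSn; apply: (filtR fF).
Qed.

Lemma bicent_id : bicent x. Proof. by []. Qed.

(** A double centraliser argument modulo [F (2 * m).+1]: [x] commutes with itself, so [z] commutes
    with [x], so [y] commutes with [z]. *)
Lemma bicentR y z : bicent y -> bicent z -> F (2 * m).+1 [~ y, z].
Proof.
move=> [Fy Cy] [Fz Cz]; apply: Cy => //; rewrite -invgR; apply: (filtV fF).
by apply: Cz => //; rewrite commgg; apply: (filt1 fF).
Qed.

Lemma filt_adjoin_filtration : filtration filt_adjoin.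
Proof.
have subF i z : 1 < i -> F (i * m).+1 z -> bicent z.
  move=> lt1i Fz; apply: bicent_sub; apply: (filt_le fF) Fz.
  by rewrite ltnS leq_pmull // ltnW.
rewrite /filt_adjoin; split=> i.
- by case: leqP => _; [apply: bicent_sub|]; apply: (filt1 fF).
- case: leqP => _ y z; last exact: (filtM fF).
  move=> [Fy Cy] [Fz Cz]; split=> [|u Fu xu]; first exact: (filtM fF).
  rewrite commg_mull; apply: (filtM fF); last exact: Cz.
  by apply: (filtJ fF); [apply: Cy | apply: (filt_0 fF) Fz].
- case: leqP => _ y; last exact: (filtV fF).
  move=> [Fy Cy]; split=> [|u Fu xu]; first exact: (filtV fF).
  rewrite commg_invl; apply: (filtJ fF); apply: (filtV fF); first exact: Cy.
  exact: (filt_0 fF) Fy.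
- move=> y; case: (leqP i 1) => [lei1|lt1i]; last first.
    by rewrite ltnNge (ltnW lt1i) /=; apply: (filt_le fF); rewrite ltnS leq_mul.
  by case: ltnP => // lt0i; apply: (subF i.+1).
move=> j y z.
have sub_m k u : (if k <= 1 then bicent else F (k * m).+1) u -> F m u /\ bicent u.
  by case: leqP => [_ Cu|/subF sF /sF Cu]; split=> //; case: Cu.
case: (leqP (i + j) 1) => [leij /sub_m[_ Cy] /sub_m[_ Cz] | ltij].
  by apply: (subF 2); last exact: bicentR.
case: (leqP i 1) => lei; case: (leqP j 1) => lej Fy Fz.
(* Here [i = j = 1]. The inclusion of both entries in [F m] would only give [F (2 * m)]; [bicentR]
   gains the missing step. *)
- apply: (filt_le fF) (bicentR Fy Fz).
  by rewrite ltnS leq_mul // (@leq_add i j 1 1).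
- case: Fy => Fy _; apply: (filt_le fF) (filtR fF Fy Fz).
  by rewrite addnS ltnS mulnDl leq_add2r -{2}[m]mul1n leq_mul.
- case: Fz => Fz _; apply: (filt_le fF) (filtR fF Fy Fz).
  by rewrite addSn ltnS mulnDl leq_add2l -{2}[m]mul1n leq_mul.
apply: (filt_le fF) (filtR fF Fy Fz).
by rewrite addSn addnS mulnDl.
Qed.

Lemma filt_adjoinE i : 1 < i -> filt_adjoin i = F (i * m).+1.
Proof. by rewrite /filt_adjoin ltnNge => /negbTE->. Qed.

End Adjoin.

Section Regular.
Variables (p q : nat).
Hypothesis q_bin : forall m, 0 < m < p -> q %| 'C(q, m).

(** Induction on [c]. The induction hypothesis shows that the elements of [F 2] killed by [q] modulo
    the last term form a group [Y], and that [Y] contains the commutators of [x] and [y] with [F 1].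
    This yields a filtration [K] with [x] and [y] in its first term, in which the Taylor
    coefficients of index at least 2 are killed by [q]. *)
Lemma expgM_filt c (T : groupType) (F : nat -> T -> Prop) (x y : T) :
    c < p -> filtration F -> (forall z, F 0 z -> F 1%N z) ->
    F 1%N x -> F 1%N y -> F c.+1 (x ^+ q) -> F c.+1 (y ^+ q) ->
  F c.+1 ((x * y) ^+ q).
Proof.
elim: c T F x y => [|c IH] T F x y ltcp fF F01 Fx Fy Zx Zy.
  by apply: (filtX fF); apply: (filtM fF).
have{IH} IH := IH T _ _ _ (ltnW ltcp).
have FE i j z : F i z -> j <= i -> F j z by move=> Fz leji; apply: (filt_le fF) Fz.
pose Z := F c.+2; pose Y z := F 2 z /\ Z (z ^+ q).
have YM u v : Y u -> Y v -> Y (u * v).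
  move=> [Fu Zu] [Fv Zv]; split; first exact: (filtM fF).
  (* This shift sends indices 0 and 1 to 2, and [c.+1] to [c.+2]. *)
  apply: (IH (F \o (fun i => i.-1.+2))) => //=.
  by apply: (filt_reindex fF) => [i|i j]; lia.
have YV u : Y u -> Y u^-1.
  by move=> [Fu Zu]; split; rewrite ?expVgn; apply: (filtV fF).
have YJ u v : Y u -> F 0 v -> Y (u ^ v).
  by move=> [Fu Zu] Fv; split; rewrite -?conjXg; apply: (filtJ fF).
have XR z u : F 1%N z -> Z (z ^+ q) -> F 1%N u -> Y [~ z, u].
  move=> Fz Zz Fu; have F2zu: F 2 [~ z, u] by apply: (filtR fF Fz Fu).
  (* For [c = 0], [Z] is [F 2] itself. Otherwise [Z] is the term of index [c.+1] once [z] is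
     adjoined to [F 2], and the induction hypothesis applies to the factors of [[~ z, u] = z^-1 * z
     ^ u]. *)
  split=> //; have [c0|c_gt0] := posnP c.
    by rewrite /Z c0; apply: (filtX fF).
  have fN := filt_adjoin_filtration fF Fz.
  have NE: filt_adjoin F 1 z c.+1 = Z by rewrite filt_adjoinE // muln1.
  rewrite commgEl -NE; apply: (IH _ _ _ fN) => //; rewrite ?NE.
  - by apply: (filtV fN (i := 1%N)); apply: bicent_id.
  - rewrite -[z ^ u](mulVKg z) -commgEl; apply: (filtM fN (i := 1%N)).
      exact: bicent_id.
    exact: bicent_sub.
  - by rewrite expVgn; apply: (filtV fF).
  by rewrite -conjXg; apply: (filtJ fF) => //; apply: FE Fu _.
pose K1 z := F 1%N z /\ forall v, F 1%N v -> Y [~ z, v].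
have YK z : Y z -> K1 z.
  move=> Yz; split=> [|v Fv]; first by case: Yz => Fz _; apply: FE Fz _.
  by rewrite commgEl; apply: YM; [apply: YV | apply: YJ => //; apply: FE Fv _].
pose K i := if (i <= 1)%N then K1 else fun z => F i z /\ Z (z ^+ q).
have KY i z : 1 < i -> F i z -> Z (z ^+ q) -> Y z.
  by move=> lt1i Fz Zz; split=> //; apply: FE Fz _.
have fK : filtration K.
  rewrite /K; split=> i.
  - case: leqP => _; last by rewrite expg1n; split; apply: (filt1 fF).
    by apply: YK; split; rewrite ?expg1n; apply: (filt1 fF).
  - case: leqP => [_ y' z|lt1i y' z [Fy' Zy'] [Fz Zz]]; last first.
      split; first exact: (filtM fF).
      by case: (YM y' z); [apply: KY lt1i _ _ | apply: KY lt1i _ _ |].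
    move=> [Fy' Cy'] [Fz Cz]; split=> [|v Fv]; first exact: (filtM fF).
    rewrite commg_mull; apply: YM; last exact: Cz.
    by apply: YJ; [apply: Cy' | apply: FE Fz _].
  - case: leqP => [_ z [Fz Cz]|_ z [Fz Zz]]; last first.
      by split; rewrite ?expVgn; apply: (filtV fF).
    split=> [|v Fv]; first exact: (filtV fF).
    rewrite commg_invl; apply: YJ; first by apply: YV; apply: Cz.
    by apply: (filtV fF); apply: FE Fz _.
  - move=> z; case: (leqP i 1) => [lei1|lt1i]; last first.
      by rewrite ltnNge (ltnW lt1i) /=; case=> Fz Zz; split=> //; apply: FE Fz _.
    by case: ltnP => // lt0i [Fz Zz]; apply/YK/(KY i.+1).
  move=> j z u.
  have K_1 k v : (if (k <= 1)%N then K1 else fun z => F k z /\ Z (z ^+ q)) v ->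
      F k v /\ K1 v.
    case: leqP => [lek Kv|lt1 [Fv Zv]]; last by split=> //; apply/YK/(KY _ _ lt1).
    by split=> //; case: Kv => Fv _; apply: FE Fv _.
  move=> /K_1[Fz Kz] /K_1[Fu [F1u _]].
  have Yzu: Y [~ z, u] by case: Kz => _; apply.
  case: leqP => _; first exact: YK.
  by split; [apply: (filtR fF) | case: Yzu].
have K1x z : F 1%N z -> Z (z ^+ q) -> K1 z by move=> Fz Zz; split=> // v; apply: XR.
have Kx := K1x x Fx Zx; have Ky := K1x y Fy Zy.
(* The exponent [n] is written ['C(n, 1)] to match [polyseq_bin]. The values at 0 and 1 are trivial,
   so the expansion starts at index 2. *)
pose f n := y^-1 ^+ 'C(n, 1) * x^-1 ^+ 'C(n, 1) * (x * y) ^+ 'C(n, 1).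
have Pf: polyseq K c.+2 f.
  do 2?apply: (polyseqM fK); apply: (polyseq_bin fK).
  - exact: (filtV fK (i:=1%N)).
  - exact: (filtV fK (i:=1%N)).
  exact: (filtM fK (i:=1%N)).
have [||Zf _] // := polyseq_eval fK (q := q) (m := 2) Pf.
- case=> [|[|//]] _; rewrite /f ?bin0 ?mulg1 // !expg1.
  by rewrite -invgM mulVg.
- move=> k a /andP[lt1k ltkc]; rewrite /K leqNgt lt1k /= => -[Fa Za].
  have /dvdnP[r ->]: q %| 'C(q, k).
    by apply: q_bin; rewrite (ltnW lt1k) (leq_trans ltkc).
  have Zar: Z (a ^+ (r * q)) by rewrite mulnC expgnA; apply: (filtX fF).
  by split=> //; apply: (filtX fF).
have ->: (x * y) ^+ q = x ^+ q * y ^+ q * f q.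
  by rewrite /f !bin1 !expVgn !mulgA mulgK mulgV mul1g.
by apply: (filtM fF) => //; apply: (filtM fF).
Qed.

End Regular.

(** * The filtration of the semidirect product *)

(** Induction on [j] by the three subgroups lemma, modulo the target term. As ['L_0] and ['L_1] are
    both [G], there are two base cases. *)
Lemma lcnR (gT : finGroupType) (G : {group gT}) i j :
  [~: 'L_i(G), 'L_j(G)] \subset 'L_(i + j)(G).
Proof.
elim: j i => [|[|j] IH] i.
- by rewrite addn0 commg_subl lcn_norm.
- by rewrite addn1 lcnSnS.
have nL k (K : {set gT}) : K \subset G -> K \subset 'N('L_k(G)).
  by move=> sKG; apply: subset_trans sKG (lcn_norm k G).
have sLG k : 'L_k(G) \subset G := lcn_sub k G.
have sR (A B : {set gT}) : A \subset G -> B \subset G -> [~: A, B] \subset G.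
  by move=> sA sB; apply: subset_trans (commgSS sA sB) (der_sub 1 G).
have step (A B C : {group gT}) : A \subset G -> B \subset G -> C \subset G ->
    [~: A, B, C] \subset 'L_(i + j.+2)(G) ->
    [~: A / 'L_(i + j.+2)(G), B / 'L_(i + j.+2)(G), C / 'L_(i + j.+2)(G)] = 1.
  move=> sA sB sC sN; rewrite -!quotientR ?nL ?sR //.
  by apply/trivgP; rewrite quotient_sub1 ?nL ?sR.
rewrite (lcnSn j) commGC -quotient_sub1 ?nL ?sR //.
rewrite !quotientR ?nL ?sR //.
apply/trivgP; apply: three_subgroup; apply: step => //=.
  rewrite (commGC G) -addSnnS (subset_trans _ (IH i.+1)) //.
  by rewrite commSg // lcnSnS.
by rewrite addnS (subset_trans _ (lcnSnS _ _)) // commSg // IH.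
Qed.

Section Wedge.
(* The relations of G /\ G read inside the semidirect product W, where the action
   of G is conjugation: j embeds G, w g h stands for g /\ h, and pr : W -> G is
   the projection with kernel G /\ G. *)
Variables (gT : finGroupType) (W : groupType).
Variables (j : gT -> W) (w : gT -> gT -> W) (pr : W -> gT).
Local Notation G := [set: gT].

Hypothesis jM : forall g h, j (g * h) = j g * j h.
Hypothesis wJ : forall g h a, w g h ^ j a = w (g ^ a) (h ^ a).
Hypothesis wMl : forall g g' h, w (g * g') h = w g' h ^ j g^-1 * w g h.
Hypothesis wMr : forall g h h', w g (h * h') = w g h * w g h' ^ j h^-1.
Hypothesis wxx : forall g, w g g = 1.
Hypothesis prM : forall x y, pr (x * y) = pr x * pr y.
Hypothesis prj : forall g, pr (j g) = g.
Hypothesis prw : forall g h, pr (w g h) = 1.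

Lemma j1 : j 1 = 1.
Proof. by apply: (mulgI (j 1)); rewrite -jM !mulg1. Qed.

Lemma jV g : j g^-1 = (j g)^-1.
Proof. by apply/esym/mulg1_eq; rewrite -jM mulgV j1. Qed.

Lemma jX g n : j (g ^+ n) = j g ^+ n.
Proof. by elim: n => [|n IH]; rewrite ?j1 // !expgS jM IH. Qed.

Lemma jR g h : j [~ g, h] = [~ j g, j h].
Proof. by rewrite /commg /conjg !jM !jV. Qed.

Lemma w1l h : w 1 h = 1.
Proof. by apply: (mulIg (w 1 h)); rewrite mul1g -{3}[1%g]mul1g wMl invg1 j1 conjg1. Qed.

Lemma w1r g : w g 1 = 1.
Proof. by apply: (mulgI (w g 1)); rewrite mulg1 -{3}[1%g]mul1g wMr invg1 j1 conjg1. Qed.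

(** Expand [w (h * g) (h * g) = 1] in both arguments. *)
Lemma w_sym g h : w g h = (w h g)^-1.
Proof.
apply: invg_inj; rewrite invgK; apply: mulg1_eq.
apply: (@conjg_inj _ (j h^-1)); rewrite conj1g conjMg.
have E : w g (h * g) = w g h by rewrite wMr wxx conj1g mulg1.
have E' : w h (h * g) = w h g ^ j h^-1 by rewrite wMr wxx mul1g.
by rewrite -(wxx (h * g)) wMl E E'.
Qed.

(* Expanding [w (g * x) (h * y)] in the two possible orders. *)
Lemma w_peiffer g h x y : w x y ^ w g h = w x y ^ j (pcomm g h).
Proof.
pose x' := x ^ (g * h); pose y' := y ^ (g * h).
have Exy : w x y = (w x' y' ^ j h^-1) ^ j g^-1.
  by rewrite /x' /y' !wJ !conjgM !conjgK.
have Exy' : w x y ^ j (pcomm g h) = (w x' y' ^ j g^-1) ^ j h^-1.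
  by rewrite /x' /y' !wJ -!conjgM /pcomm !mulgA.
move: x' y' Exy Exy' => x' y' Exy Exy'.
have := wMl g x' (h * y'); rewrite !wMr !wMl.
rewrite [(_ * w g y') ^ _]conjMg [(w x' h * _) ^ _]conjMg -Exy' -Exy.
move: (w x' h ^ _) (w g y' ^ _) (w x y ^ _) => a b c.
(* Cancelling the outer factors leaves [w g h * w x y ^ j (pcomm g h) = w x y * w g h]. *)
by rewrite !mulgA => /mulIg; rewrite -!mulgA => /mulgI E; rewrite conjgE -E mulKg.
Qed.

(** Two expansions of [w g (y ^ z^-1)] are compared: one from [y ^ z^-1 = pcomm z y * y], where
    [w_peiffer] replaces conjugation by [j (pcomm z y)] with conjugation by [w z y], the other from
    [g * z = z * g ^ z]. *)
Lemma w_pcomm g z y : w g (pcomm z y) = w z y ^ j g^-1 * (w z y)^-1.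
Proof.
have Ey : y ^ z^-1 = pcomm z y * y by rewrite /pcomm conjgE invgK mulgA mulgKV.
have E1 : w g (y ^ z^-1) = w g (pcomm z y) * w g y ^ (w z y)^-1.
  rewrite Ey wMr jV; congr (_ * _); apply: (@conjg_inj _ (w z y)).
  apply: esym; rewrite conjgKV -{1}[w g y](conjgKV (j (pcomm z y))).
  by rewrite -jV wJ -w_peiffer.
have E2 : w g (y ^ z^-1) * w z y = w z y ^ j g^-1 * w g y.
  rewrite -wMl; have -> : g * z = z * g ^ z by rewrite conjgC.
  by rewrite wMl wJ conjgK.
apply: (mulIg (w g y ^ (w z y)^-1)); rewrite -E1.
by apply: (mulIg (w z y)); rewrite E2; move: (w z y ^ _) => a; rewrite conjgE invgK !mulgA !mulgKV.
Qed.

(** For a normal subgroup [A], the image of the tensor product of [A] and [G] in G /\ G. *)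
Inductive wgen (A : {set gT}) : W -> Prop :=
| wgen1 : wgen A 1
| wgenMl x y e : x \in A -> wgen A e -> wgen A (w x y * e)
| wgenVl x y e : x \in A -> wgen A e -> wgen A ((w x y)^-1 * e).

Section Wgen.
Variable A : {group gT}.

Lemma wgenM e f : wgen A e -> wgen A f -> wgen A (e * f).
Proof.
by elim=> [|x y {}e Ax _ IH|x y {}e Ax _ IH] Af; rewrite ?mul1g // -mulgA;
  [apply: wgenMl | apply: wgenVl]; auto.
Qed.

Lemma wgen_w x y : x \in A -> wgen A (w x y).
Proof. by move=> Ax; rewrite -[w x y]mulg1; apply: wgenMl => //; apply: wgen1. Qed.

Lemma wgenV e : wgen A e -> wgen A e^-1.
Proof.
elim=> [|x y {}e Ax _ IH|x y {}e Ax _ IH]; rewrite ?invg1 ?invgM ?invgK.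
- exact: wgen1.
- by apply: wgenM => //; rewrite -[_^-1]mulg1; apply: wgenVl => //; apply: wgen1.
by apply: wgenM => //; apply: wgen_w.
Qed.

Lemma wgenS (B : {set gT}) e : A \subset B -> wgen A e -> wgen B e.
Proof.
move=> /subsetP sAB; elim=> [|x y {}e /sAB Bx _ IH|x y {}e /sAB Bx _ IH].
- exact: wgen1.
- exact: wgenMl.
exact: wgenVl.
Qed.

Lemma pr_wgen e : wgen A e -> pr e = 1.
Proof.
have pr1 : pr 1 = 1 by apply: (mulgI (pr 1)); rewrite -prM !mulg1.
elim=> // x y {}e Ax _ IH; rewrite prM IH ?prw mulg1 //.
by apply: (mulgI (pr (w x y))); rewrite -prM mulgV pr1 prw mulg1.
Qed.

Hypothesis nA : A <| G.

Lemma wgenJ e a : wgen A e -> wgen A (e ^ j a).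
Proof.
have nAa : a \in 'N(A) by apply: subsetP (normal_norm nA) _ (in_setT _).
elim=> [|x y {}e Ax _ IH|x y {}e Ax _ IH].
- by rewrite conj1g; apply: wgen1.
- by rewrite conjMg wJ; apply: wgenMl => //; rewrite memJ_norm.
by rewrite conjMg conjVg wJ; apply: wgenVl => //; rewrite memJ_norm.
Qed.

Lemma wgen_wJE B e g h : wgen B e -> e ^ w g h = e ^ j (pcomm g h).
Proof.
elim=> [|x y {}e _ _ IH|x y {}e _ _ IH]; first by rewrite !conj1g.
  by rewrite !conjMg IH w_peiffer.
by rewrite !conjMg !conjVg IH w_peiffer.
Qed.

(** Generators of G /\ G act on [e] like commutators of [G], so [wgenJ] suffices. *)
Lemma wgenJw e f : wgen A e -> wgen G f -> wgen A (e ^ f).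
Proof.
move=> Ae Gf; elim: Gf e Ae => [|x y {}f _ _ IH|x y {}f _ _ IH] e Ae.
- by rewrite conjg1.
- by rewrite conjgM; apply: IH; rewrite (wgen_wJE _ _ Ae); apply: wgenJ.
rewrite conjgM; apply: IH.
suff -> : e ^ (w x y)^-1 = e ^ j (pcomm x y)^-1 by apply: wgenJ.
have Ae' := wgenJ (pcomm x y)^-1 Ae.
by rewrite -[e in LHS](conjgKV (j (pcomm x y))) -jV -(wgen_wJE _ _ Ae') conjgK.
Qed.

End Wgen.

Definition Lc i : {group gT} := 'L_i([set: gT])%G.

Lemma Lc_normal i : Lc i <| G. Proof. exact: lcn_normal. Qed.

Lemma Lc_S i k : k <= i -> Lc i \subset Lc k. Proof. exact: lcn_sub_leq. Qed.

Lemma Lc_J i x a : x \in Lc i -> x ^ a \in Lc i.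
Proof.
by move=> Lx; rewrite memJ_norm //; apply: (subsetP (normal_norm (Lc_normal i))); rewrite inE.
Qed.

Lemma Lc_0 x : x \in Lc 0. Proof. exact: in_setT. Qed.

(* If H is a covering group of G, then G /\ G is [H, H] and, for i >= 2, this
   is the i-th term of the lower central series of H. *)
Definition wlcn i := wgen (Lc i.-1).
Definition jwlcn i x := exists g e, [/\ g \in Lc i, wlcn i e & x = j g * e].

Lemma wlcnS i k e : k <= i -> wlcn i e -> wlcn k e.
Proof. by move=> leki; apply/wgenS/Lc_S; lia. Qed.

Lemma wlcn_J i e a : wlcn i e -> wlcn i (e ^ j a).
Proof. exact: (@wgenJ (Lc i.-1) (Lc_normal _) e a). Qed.

Lemma wlcn_Jw i k e f : wlcn i e -> wlcn k f -> wlcn i (e ^ f).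
Proof. by move=> Ee /(wlcnS (leq0n k)); apply: (@wgenJw (Lc i.-1) (Lc_normal _)). Qed.

Lemma wlcn_M i e f : wlcn i e -> wlcn i f -> wlcn i (e * f).
Proof. exact: wgenM. Qed.

Lemma wlcn_V i e : wlcn i e -> wlcn i e^-1.
Proof. exact: wgenV. Qed.

Lemma wlcn_w0 x y : wlcn 0 (w x y).
Proof. by apply: wgen_w; rewrite inE. Qed.

Lemma pcomm_lcn i k g h : g \in Lc i -> h \in Lc k -> pcomm g h \in Lc (i + k).
Proof.
move=> Lg Lh; have -> : pcomm g h = [~ g^-1, h^-1] by rewrite /pcomm /commg /conjg !gnorm.
by apply: (subsetP (lcnR _ i k)); rewrite mem_commg ?groupV.
Qed.

(** Induction on [k]. For [h = pcomm z y], [w_pcomm] gives [w (z ^ g^-1) (y ^ g^-1) * (w z y)^-1];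
    writing the conjugates as [a * z] and [b * y] and expanding, [w z y] cancels. The remaining
    factors involve [a], which is deep enough, or pair [b], one step deeper than [g], with an
    element of [Lc k.-1], for the [k] of the statement. *)
Lemma w_lcn i k g h : g \in Lc i -> h \in Lc k -> wlcn (i + k) (w g h).
Proof.
elim: k i g h => [|[|k] IH] i g h Lg Lh.
- by apply: wgen_w; rewrite addn0; apply: (subsetP (Lc_S _)) Lg; lia.
- by apply: wgen_w; rewrite addn1.
move: Lh; rewrite /Lc /= lcnSn => /gen_prodgP[n [c cS ->]].
elim/big_rec: _ => [|m h' _ IHh]; first by rewrite w1r; apply: wgen1.
rewrite wMr; apply: wlcn_M; last exact: wlcn_J.
have /imset2P[z0 y0 Lz0 _ Ec] := cS m.
pose z := z0^-1; pose y := y0^-1.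
have Lz : z \in Lc (k.+1) by rewrite groupV.
have {Ec} -> : c m = pcomm z y by rewrite Ec /pcomm /commg /conjg !gnorm.
have Lzy : pcomm z y \in Lc (k.+1)
  by have := pcomm_lcn Lz (Lc_0 y); rewrite addn0.
rewrite w_pcomm; set t := w z y.
have Ez : z ^ g^-1 = pcomm g z * z by rewrite /pcomm conjgE invgK mulgA mulgKV.
have Ey : y ^ g^-1 = pcomm g y * y by rewrite /pcomm conjgE invgK mulgA mulgKV.
set a := pcomm g z in Ez; set b := pcomm g y in Ey.
have La : a \in Lc (i + k.+1) by apply: pcomm_lcn.
have Lb : b \in Lc (i.+1) by rewrite -addn1; apply: pcomm_lcn => //; rewrite inE.
rewrite wJ Ez Ey wMl wMr.
have -> : t ^ j b^-1 = w b (pcomm z y) * t by rewrite w_pcomm mulgKV.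
rewrite mulgA conjMg.
have -> : t ^ j a^-1 = w a (pcomm z y) * t by rewrite w_pcomm mulgKV.
have Ea u : wlcn (i + k.+2) (w a u).
  by apply: wgen_w; rewrite addnS.
rewrite [X in wlcn _ X](_ : _ =
    (w z b * w b (pcomm z y)) ^ j a^-1 * w a (pcomm z y) *
    w a (b * y) ^ t^-1); last by rewrite [w a _ ^ _]conjgE invgK !mulgA.
have IHb u : u \in Lc (k.+1) -> wlcn (i + k.+2) (w b u).
  by rewrite addnS -addSn; apply: IH.
apply: wlcn_M; last exact: wlcn_Jw (wlcn_V (wlcn_w0 _ _)).
apply: wlcn_M => //; apply: wlcn_J; apply: wlcn_M; last exact: IHb.
by rewrite w_sym; apply: wlcn_V; apply: IHb.
Qed.

(** By [w_pcomm], [[~ j g, w x y]] is conjugate to the inverse of [w g^-1 (pcomm x y)], to which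
    [w_lcn] applies. *)
Lemma commg_j_wlcn i k g e :
  g \in Lc i -> wlcn k e -> wlcn (i + k) [~ j g, e].
Proof.
move=> Lg.
have Ew x y : x \in Lc (k.-1) -> wlcn (i + k) [~ j g, w x y].
  move=> Lx; have -> : [~ j g, w x y] = ((w g^-1 (pcomm x y))^-1) ^ w x y.
    by rewrite w_pcomm invgK /commg /conjg !gnorm.
  apply: wlcn_Jw (wlcn_w0 x y); apply: wlcn_V; apply: w_lcn; first by rewrite groupV.
  by apply: (subsetP (Lc_S _)) (pcomm_lcn (k := 1) Lx (in_setT y)); lia.
elim=> [|x y {}e Lx Ee IH|x y {}e Lx Ee IH].
- by rewrite commg1; apply: wgen1.
- by rewrite commg_mulr; apply: wlcn_M => //; apply: wlcn_Jw Ee; apply: Ew.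
rewrite commg_mulr; apply: wlcn_M => //; apply: wlcn_Jw Ee.
have -> : [~ j g, (w x y)^-1] = ([~ j g, w x y]^-1) ^ (w x y)^-1.
  by rewrite /commg /conjg !gnorm.
by apply: wlcn_Jw (wlcn_V (wlcn_w0 x y)); apply/wlcn_V/Ew.
Qed.

(** Since [w x y] acts on G /\ G as [j (pcomm x y)], this reduces to [commg_j_wlcn]. *)
Lemma commg_wlcn i k e f : wlcn i e -> wlcn k f -> wlcn (i + k) [~ e, f].
Proof.
move=> Ee Ef.
have Ew x y : x \in Lc (i.-1) -> wlcn (i + k) [~ w x y, f].
  move=> Lx; have -> : [~ w x y, f] = [~ j (pcomm x y), f].
    by rewrite -invgR -[RHS]invgR !commgEl (wgen_wJE _ _ Ef).
  apply: commg_j_wlcn => //; by apply: (subsetP (Lc_S _)) (pcomm_lcn (k := 1) Lx (in_setT y)); lia.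
elim: Ee => [|x y {}e Lx Ee IH|x y {}e Lx Ee IH].
- by rewrite comm1g; apply: wgen1.
- by rewrite commg_mull; apply: wlcn_M => //; apply: wlcn_Jw Ee; apply: Ew.
rewrite commg_mull; apply: wlcn_M => //; apply: wlcn_Jw Ee.
rewrite commg_invl; apply: wlcn_Jw (wlcn_V (wlcn_w0 x y)); exact/wlcn_V/Ew.
Qed.

Lemma jwlcn_w i e : wlcn i e -> jwlcn i e.
Proof. by exists 1, e; rewrite j1 mul1g; split. Qed.

Lemma jwlcn_j i g : g \in Lc i -> jwlcn i (j g).
Proof. by exists g, 1; rewrite mulg1; split=> //; apply: wgen1. Qed.

Lemma jwlcn_M i x y : jwlcn i x -> jwlcn i y -> jwlcn i (x * y).
Proof.
move=> [g [e [Lg Ee ->]]] [h [f [Lh Ef ->]]].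
exists (g * h), (e ^ j h * f); split; first exact: groupM.
  by apply: wlcn_M => //; apply: wlcn_J.
by rewrite jM /conjg !gnorm.
Qed.

Lemma jwlcn_V i x : jwlcn i x -> jwlcn i x^-1.
Proof.
move=> [g [e [Lg Ee ->]]]; rewrite invgM conjgC -jV.
by apply: jwlcn_M; [apply/jwlcn_j/groupVr | apply/jwlcn_w/wlcn_J/wlcn_V].
Qed.

Lemma jwlcn_J i k x g : jwlcn i x -> jwlcn k g -> jwlcn i (x ^ g).
Proof.
move=> [h [e [Lh Ee ->]]] [a [f [La Ef ->]]].
rewrite conjgM conjMg.
have -> : j h ^ j a = j (h ^ a) by rewrite /conjg !jM jV.
rewrite conjMg -[j (h ^ a) ^ f](mulKVg (j (h ^ a))) -commgEl.
have Lha : h ^ a \in Lc i by apply: Lc_J.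
apply: jwlcn_M; first apply: jwlcn_M; first exact: jwlcn_j.
  apply: jwlcn_w; have := commg_j_wlcn Lha (wlcnS (leq0n _) Ef).
  by rewrite addn0.
by apply: jwlcn_w; apply: wlcn_Jw Ef; apply: wlcn_J.
Qed.

Lemma jwlcn_filtration : filtration jwlcn.
Proof.
split=> [i|i|i|i x|i k x y].
- by apply: jwlcn_w; apply: wgen1.
- exact: jwlcn_M.
- exact: jwlcn_V.
- move=> [g [e [Lg Ee ->]]]; exists g, e; split=> //; last exact: wlcnS Ee.
  by apply: (subsetP (Lc_S _)) Lg.
move=> [g [e [Lg Ee ->]]] [h [f [Lh Ef ->]]].
have Je : jwlcn 0 e := jwlcn_w (wlcnS (leq0n _) Ee).
have Jf : jwlcn 0 f := jwlcn_w (wlcnS (leq0n _) Ef).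
rewrite commg_mull (commg_mulr (j g)) (commg_mulr e); apply: jwlcn_M; last apply: jwlcn_M.
- apply: jwlcn_J Je; apply: jwlcn_M; first by apply: jwlcn_w; apply: commg_j_wlcn.
  apply: jwlcn_J Jf; rewrite -jR; apply: jwlcn_j.
  by apply: (subsetP (lcnR _ i k)); rewrite mem_commg.
- by apply: jwlcn_w; apply: commg_wlcn.
apply: jwlcn_J Jf; rewrite -invgR; apply: jwlcn_V; apply: jwlcn_w.
by rewrite addnC; apply: commg_j_wlcn.
Qed.

(** The conjugations by [j x] produced by [wMl] telescope. *)
Lemma w_exp x y n : w (x ^+ n) y = j x ^+ n * ((j x)^-1 * w x y) ^+ n.
Proof.
elim: n => [|n IH]; first by rewrite w1l mulg1.
rewrite expgS wMl IH jV conjgE invgK.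
by rewrite [j x ^+ n.+1]expgS [_ ^+ n.+1]expgSr !mulgA.
Qed.

(** * The exponent of the exterior square *)

Section Exponent.
Variables p q : nat.
Hypothesis p_gt1 : 1 < p.
Hypothesis q_bin : forall m, 0 < m < p -> q %| 'C(q, m).
Hypothesis expGq : forall g : gT, g ^+ q = 1.

Lemma jwlcn_pr i e : jwlcn i e -> pr e = 1 -> wlcn i e.
Proof.
move=> [g [f [_ Ef ->]]]; rewrite prM prj (pr_wgen Ef) mulg1 => ->.
by rewrite j1 mul1g.
Qed.

Lemma wlcn_exp_step s e : wlcn s.+1 e -> wlcn (p * s).+1 (e ^+ q).
Proof.
have step z x y : jwlcn s z -> bicent jwlcn s z x -> bicent jwlcn s z y ->
    jwlcn (p * s).+1 (x ^+ q) -> jwlcn (p * s).+1 (y ^+ q) ->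
    jwlcn (p * s).+1 ((x * y) ^+ q).
  move=> Fz; have fN := filt_adjoin_filtration jwlcn_filtration Fz.
  have NE : filt_adjoin jwlcn s z p = jwlcn (p * s).+1 by rewrite filt_adjoinE.
  (* Here [expgM_filt] is used with [c = p.-1], the largest value it allows. *)
  move=> Nx Ny; rewrite -NE -(ltn_predK p_gt1).
  by apply: (expgM_filt q_bin) => //; lia.
have Fw x y : x \in Lc s -> jwlcn (p * s).+1 (w x y ^+ q).
  move=> Lx; have Fjx := jwlcn_j Lx.
  have Nw : bicent jwlcn s (j x) (w x y).
    by apply: (bicent_sub jwlcn_filtration); apply/jwlcn_w/wgen_w.
  have Nx : bicent jwlcn s (j x) (j x) by apply: bicent_id.
  have F1 : jwlcn (p * s).+1 1 := filt1 jwlcn_filtration _.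
  have jxq : j x ^+ q = 1 by rewrite -jX expGq j1.
  rewrite -[w x y](mulVKg (j x)); apply: (step (j x)) => //.
  - have fN := filt_adjoin_filtration jwlcn_filtration Fjx.
    by apply: (filtM fN (i := 1%N)) => //; apply: (filtV fN (i := 1%N)).
  - by rewrite jxq.
  by have := w_exp x y q; rewrite expGq w1l jxq mul1g => <-.
move=> Ee; apply: jwlcn_pr; last first.
  have pr1 : pr 1 = 1 by rewrite -j1 prj.
  by elim: q => [|n IH]; rewrite ?expgS ?prM ?IH ?(pr_wgen Ee) ?mulg1.
(* Products of generators with different [x] are treated with 1 adjoined: the first term still
   contains [jwlcn s.+1]. *)
have F1 : jwlcn s 1 := filt1 jwlcn_filtration _.
have Ns u : wlcn s.+1 u -> bicent jwlcn s 1 u.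
  by move=> Eu; apply: (bicent_sub jwlcn_filtration); apply: jwlcn_w.
elim: Ee => [|x y {}e Lx Ee IH|x y {}e Lx Ee IH].
- by rewrite expg1n; apply: (filt1 jwlcn_filtration).
- by apply: (step 1) => //; [apply/Ns/wgen_w | apply: Ns | apply: Fw].
apply: (step 1) => //; [apply/Ns/wlcn_V/wgen_w | apply: Ns |] => //.
by rewrite expVgn; apply: (filtV jwlcn_filtration); apply: Fw.
Qed.

(** The iteration starts at [2 = (p ^ 0).+1], and [wlcn 2] is all of G /\ G because ['L_1] is
    [G]. *)
Lemma wlcn_exp n e : wlcn 2 e -> wlcn (p ^ n).+1 (e ^+ (q ^ n)).
Proof.
move=> Ee; elim: n => [|n IH] //.
by rewrite (expnSr q) expgnA (expnS p); apply: wlcn_exp_step.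
Qed.

Lemma wgen_exp n e : Lc (p ^ n) :=: 1 -> wgen G e -> e ^+ (q ^ n) = 1.
Proof.
move=> L1 /(@wlcn_exp n); rewrite /wlcn [X in wgen X]L1.
by elim=> [//|x y f|x y f] /set1P-> _ ->; rewrite w1l ?invg1 mulg1.
Qed.

End Exponent.

End Wedge.

(** * Construction of the exterior square and of the semidirect product *)

Section ExtGroup.
Variable gT : finGroupType.
Local Notation word := (ext_word gT).
Local Notation rel := (ext_rel [set: gT]).
Implicit Types u v : word.

Definition winv u : word := rev [seq (~~ l.1, l.2) | l <- u].
Definition wact u (a : gT) : word := [seq (l.1, (l.2.1 ^ a, l.2.2 ^ a)) | l <- u].

Lemma ext_rel_cat u u' v v' : rel u u' -> rel v v' -> rel (u ++ v) (u' ++ v').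
Proof.
move=> Ru Rv; apply: (@ext_trans _ _ _ (u' ++ v)).
  exact: (ext_cong [::] v Ru).
by have := ext_cong u' [::] Rv; rewrite !cats0.
Qed.

Lemma winvK : involutive winv.
Proof. by move=> u; rewrite /winv map_rev revK -map_comp map_id_in // => -[[] ?]. Qed.

Lemma ext_rel_winvr u : rel (u ++ winv u) [::].
Proof.
elim: u => [|[b x] u IH]; first exact: ext_refl.
rewrite /winv /= rev_cons -cats1 catA; apply: ext_trans (ext_cancel _ b x).
exact: (ext_cong [:: (b, x)] [:: (~~ b, x)] IH).
Qed.

Lemma ext_rel_winvl u : rel (winv u ++ u) [::].
Proof. by rewrite -{2}[u]winvK; apply: ext_rel_winvr. Qed.

Lemma ext_rel_wact a u v : rel u v -> rel (wact u a) (wact v a).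
Proof.
have JV (x y : gT) : (x ^ y^-1) ^ a = (x ^ a) ^ (y ^ a)^-1 by rewrite conjJg conjVg.
elim=> {u v} [u|u v _|u v x _ IH1 _|x u v y _ IH|b x|g g' h _ _ _|g h h' _ _ _|g _].
- exact: ext_refl.
- exact: ext_sym.
- exact: ext_trans IH1.
- by rewrite /wact !map_cat; apply: ext_cong.
- exact: ext_cancel.
- by rewrite /wact /= conjMg !JV; apply: ext_mull; rewrite inE.
- by rewrite /wact /= conjMg !JV; apply: ext_mulr; rewrite inE.
by apply: ext_diag; rewrite inE.
Qed.

(** Classical truth value of the relation: the quotient type is built from a boolean equivalence. *)
Definition erel u v := boolp.asbool (rel u v).

Lemma erel_refl : reflexive erel.
Proof. by move=> u; apply/boolp.asboolP/ext_refl. Qed.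
Lemma erel_sym : symmetric erel.
Proof. by move=> u v; apply/boolp.asboolP/boolp.asboolP; apply: ext_sym. Qed.
Lemma erel_trans : transitive erel.
Proof.
move=> v u w /boolp.asboolP Ruv /boolp.asboolP Rvw.
exact/boolp.asboolP/(ext_trans Ruv Rvw).
Qed.

Definition erel_equiv := EquivRel erel erel_refl erel_sym erel_trans.

Definition ext_square : Type := {eq_quot erel_equiv}.
HB.instance Definition _ := Choice.on ext_square.

Definition ecls u : ext_square := (\pi_({eq_quot erel_equiv}) u)%qT.
Definition ecls_repr (x : ext_square) : word := repr (x : {eq_quot erel_equiv}).

Lemma ecls_reprK : cancel ecls_repr ecls. Proof. exact: reprK. Qed.

Lemma eclsP u v : ecls u = ecls v <-> rel u v.
Proof.
split=> [/eqmodP/boolp.asboolP //|Ruv].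
by apply/eqmodP/boolp.asboolP.
Qed.

Lemma ecls_reprP u : rel (ecls_repr (ecls u)) u.
Proof. by apply/eclsP; rewrite ecls_reprK. Qed.

Definition emul x y := ecls (ecls_repr x ++ ecls_repr y).
Definition einv x := ecls (winv (ecls_repr x)).

Lemma emulE u v : emul (ecls u) (ecls v) = ecls (u ++ v).
Proof. by apply/eclsP/ext_rel_cat; apply: ecls_reprP. Qed.

Lemma ecls_ind (P : ext_square -> Prop) : (forall u, P (ecls u)) -> forall x, P x.
Proof. by move=> Pu x; rewrite -[x]ecls_reprK. Qed.

Fact emulA : associative emul.
Proof.
by elim/ecls_ind=> u; elim/ecls_ind=> v; elim/ecls_ind=> x; rewrite !emulE catA.
Qed.
Fact emul1 : left_id (ecls [::]) emul.
Proof. by elim/ecls_ind=> u; rewrite emulE. Qed.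
Fact e1mul : right_id (ecls [::]) emul.
Proof. by elim/ecls_ind=> u; rewrite emulE cats0. Qed.
Fact emulV : left_inverse (ecls [::]) einv emul.
Proof.
move=> x; rewrite -{2}[x]ecls_reprK emulE; apply/eclsP; exact: ext_rel_winvl.
Qed.
Fact eVmul : right_inverse (ecls [::]) einv emul.
Proof.
move=> x; rewrite -{1}[x]ecls_reprK emulE; apply/eclsP; exact: ext_rel_winvr.
Qed.

HB.instance Definition _ := isGroup.Build ext_square emulA emul1 e1mul emulV eVmul.

Lemma ecls_cat u v : ecls (u ++ v) = ecls u * ecls v.
Proof. by rewrite -emulE. Qed.

Definition wedge g h := ecls [:: (false, (g, h))].

Lemma ecls_letterV g h : ecls [:: (true, (g, h))] = (wedge g h)^-1.
Proof.
apply/esym/mulg1_eq; rewrite -ecls_cat; apply/eclsP; exact: ext_cancel.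
Qed.

Definition eact (x : ext_square) a := ecls (wact (ecls_repr x) a).

Lemma eact_ecls u a : eact (ecls u) a = ecls (wact u a).
Proof. by apply/eclsP/ext_rel_wact/ecls_reprP. Qed.

Lemma eactM a : {morph eact^~ a : x y / x * y}.
Proof.
elim/ecls_ind=> u; elim/ecls_ind=> v.
by rewrite -ecls_cat !eact_ecls /wact map_cat ecls_cat.
Qed.

Lemma eact1g x : eact x 1 = x.
Proof.
elim/ecls_ind: x => u; rewrite eact_ecls; congr ecls.
by rewrite /wact map_id_in // => -[b [g h]] _ /=; rewrite !conjg1.
Qed.

Lemma eactMg x a b : eact x (a * b) = eact (eact x a) b.
Proof.
elim/ecls_ind: x => u; rewrite !eact_ecls /wact -map_comp; congr ecls.
by apply: eq_map => -[c [g h]] /=; rewrite !conjgM.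
Qed.

Lemma eact1 a : eact 1 a = 1. Proof. exact: eact_ecls. Qed.

(** The pair [(g, e)] stands for [g] times [e] in this order, whence the right action in
    [sd_mul]. *)
Definition ext_sdprod : Type := gT * ext_square.
HB.instance Definition _ := Choice.on ext_sdprod.

Definition sd_mul (x y : ext_sdprod) : ext_sdprod := (x.1 * y.1, eact x.2 y.1 * y.2).
Definition sd_inv (x : ext_sdprod) : ext_sdprod := (x.1^-1, eact x.2^-1 x.1^-1).

Fact sd_mulA : associative sd_mul.
Proof. by move=> x y z; rewrite /sd_mul /= !mulgA eactM eactMg. Qed.
Fact sd_mul1 : left_id (1, 1) sd_mul.
Proof. by case=> g e; rewrite /sd_mul /= eact1 !mul1g. Qed.
Fact sd_1mul : right_id (1, 1) sd_mul.
Proof. by case=> g e; rewrite /sd_mul /= eact1g !mulg1. Qed.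
Fact sd_mulV : left_inverse (1, 1) sd_inv sd_mul.
Proof.
case=> g e; rewrite /sd_mul /= -eactMg !mulVg eact1g mulVg //.
Qed.
Fact sd_Vmul : right_inverse (1, 1) sd_inv sd_mul.
Proof. by case=> g e; rewrite /sd_mul /= -eactM !mulgV eact1. Qed.

HB.instance Definition _ := isGroup.Build ext_sdprod
  sd_mulA sd_mul1 sd_1mul sd_mulV sd_Vmul.

Definition sd_j (g : gT) : ext_sdprod := (g, 1).
Definition sd_e (e : ext_square) : ext_sdprod := (1, e).
Definition sd_w g h := sd_e (wedge g h).

Lemma sd_mulE (x y : ext_sdprod) : x * y = sd_mul x y.
Proof. by []. Qed.

Lemma sd_jM g h : sd_j (g * h) = sd_j g * sd_j h.
Proof. by rewrite sd_mulE /sd_mul /= eact1 mulg1. Qed.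

Lemma sd_eM e f : sd_e (e * f) = sd_e e * sd_e f.
Proof. by rewrite sd_mulE /sd_mul /= eact1g mulg1. Qed.

Lemma sd_eJ e a : sd_e e ^ sd_j a = sd_e (eact e a).
Proof.
apply: (mulgI (sd_j a)); rewrite conjgE mulVKg !sd_mulE /sd_mul /=.
by rewrite eact1 !mulg1 !mul1g.
Qed.

Lemma wedgeJ g h a : eact (wedge g h) a = wedge (g ^ a) (h ^ a).
Proof. exact: eact_ecls. Qed.

Lemma sd_wJ g h a : sd_w g h ^ sd_j a = sd_w (g ^ a) (h ^ a).
Proof. by rewrite sd_eJ wedgeJ. Qed.

Lemma sd_wMl g g' h : sd_w (g * g') h = sd_w g' h ^ sd_j g^-1 * sd_w g h.
Proof.
rewrite sd_wJ -sd_eM -ecls_cat; congr sd_e.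
by apply/eclsP/ext_mull; rewrite inE.
Qed.

Lemma sd_wMr g h h' : sd_w g (h * h') = sd_w g h * sd_w g h' ^ sd_j h^-1.
Proof.
rewrite sd_wJ -sd_eM -ecls_cat; congr sd_e.
by apply/eclsP/ext_mulr; rewrite inE.
Qed.

Lemma sd_wxx g : sd_w g g = 1.
Proof. by congr sd_e; apply/eclsP/ext_diag; rewrite inE. Qed.

Lemma sd_eX e n : sd_e (e ^+ n) = sd_e e ^+ n.
Proof. by elim: n => // n IH; rewrite !expgS sd_eM IH. Qed.

Lemma sd_e_wgen e : wgen sd_w [set: gT] (sd_e e).
Proof.
elim/ecls_ind: e; elim=> [|[b [g h]] u IH]; first exact: wgen1.
rewrite -cat1s ecls_cat sd_eM; case: b; last exact: wgenMl.
rewrite ecls_letterV.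
have -> : sd_e (wedge g h)^-1 = (sd_w g h)^-1.
  by apply/esym/mulg1_eq; rewrite -sd_eM mulgV.
exact: wgenVl.
Qed.

Lemma ecls_pow u n : ecls (ext_pow u n) = ecls u ^+ n.
Proof. by elim: n => // n IH; rewrite expgS -IH -ecls_cat. Qed.

Lemma ext_rel_setT_pow p q n (u : word) :
    1 < p -> (forall m, 0 < m < p -> q %| 'C(q, m)) ->
    (forall g : gT, g ^+ q = 1) -> 'L_(p ^ n)([set: gT]) = 1 ->
  rel (ext_pow u (q ^ n)) [::].
Proof.
move=> p_gt1 q_bin Gq L1; apply/eclsP; rewrite ecls_pow.
pose pr (x : ext_sdprod) := x.1.
have := wgen_exp (W := ext_sdprod) (pr := pr) sd_jM sd_wJ sd_wMl sd_wMr sd_wxx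
  (fun _ _ => erefl) (fun=> erefl) (fun _ _ => erefl) p_gt1 q_bin Gq L1
  (sd_e_wgen (ecls u)).
by rewrite -sd_eX => -[].
Qed.

End ExtGroup.

(** * Arithmetic of the exponent, and transfer to a subgroup *)

(** From [m * 'C(q, m) = q * 'C(q.-1, m.-1)] and Gauss's lemma. *)
Lemma dvdn_bin_coprime q m : coprime q m -> 0 < m -> q %| 'C(q, m).
Proof.
case: m => // m co_qm _; case: q co_qm => [|q] co_qm; first by rewrite bin0n.
by rewrite -(Gauss_dvdr _ co_qm) -mul_bin_diag dvdn_mulr.
Qed.

(** For [c > 1] the logarithm is positive, so passing from [p.-1] to [p] makes the bound strict. For
    [c = 1] it is 0 and the inequality fails. *)
Lemma leq_expn_up_log p c :
  2 < p -> c != 1%N -> c < p ^ up_log p.-1 c.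
Proof.
move=> p_gt2 c_neq1; have p_gt0 : 0 < p := ltnW (ltnW p_gt2).
have p1_gt1 : 1 < p.-1 by rewrite ltn_predRL.
have [c_le1 | c_gt1] := leqP c 1.
  by case: c c_le1 c_neq1 => [|[|]] // _ _; rewrite expn_gt0 p_gt0.
apply: leq_ltn_trans (up_logP c p1_gt1) _.
by rewrite ltn_exp2r ?up_log_gt0 ?p1_gt1 // ltn_predL.
Qed.

Section Transfer.
Variables (gT : finGroupType) (G : {group gT}).

(** The exterior square was built for a whole type; words over the type [subg_of G] carry the result
    to [G]. *)
Definition word_sgval (u : ext_word (subg_of G)) : ext_word gT :=
  [seq (l.1, (sgval l.2.1, sgval l.2.2)) | l <- u].

Lemma ext_rel_sgval u v : ext_rel [set: subg_of G] u v ->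
  ext_rel G (word_sgval u) (word_sgval v).
Proof.
elim=> {u v} [u|u v _|u v x _ IH1 _|x u v y _ IH|b x|g g' h _ _ _|g h h' _ _ _|g _].
- exact: ext_refl.
- exact: ext_sym.
- exact: ext_trans IH1.
- by rewrite /word_sgval !map_cat; apply: ext_cong.
- exact: ext_cancel.
- by apply: ext_mull; apply: subgP.
- by apply: ext_mulr; apply: subgP.
by apply: ext_diag; apply: subgP.
Qed.

Lemma word_sgval_surj w : ext_word_in G w -> exists u, word_sgval u = w.
Proof.
move=> Gw; exists [seq (l.1, (subg G l.2.1, subg G l.2.2)) | l <- w].
rewrite /word_sgval -map_comp map_id_in // => -[b [g h]] /(allP Gw)/andP[/= Gg Gh].
by rewrite !subgK.
Qed.

Lemma word_sgval_pow u n : word_sgval (ext_pow u n) = ext_pow (word_sgval u) n.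
Proof. by elim: n => // n IH; rewrite [LHS]map_cat; congr (_ ++ _). Qed.

End Transfer.

Theorem theorem5p6 (gT : finGroupType) (G : {group gT}) (p : nat) :
  prime p -> odd p -> p.-group G -> nil_class G != 1%N ->
  ext_exponent_dvd G (exponent G ^ up_log p.-1 (nil_class G))%N /\
  schur_exponent_dvd G (exponent G ^ up_log p.-1 (nil_class G))%N.
Proof.
move=> p_pr p_odd pG cG.
suff expE : ext_exponent_dvd G (exponent G ^ up_log p.-1 (nil_class G))%N.
  by split=> // w Gw _; apply: expE.
move=> _ /word_sgval_surj[u <-]; rewrite -word_sgval_pow.
apply: (@ext_rel_sgval _ G _ [::]); apply: (@ext_rel_setT_pow _ p).
- exact: prime_gt1.
- move=> m /andP[m_gt0 lt_mp]; apply: dvdn_bin_coprime => //.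
  apply: (@pnat_coprime p); first by rewrite pnat_exponent.
  by rewrite p'natE // gtnNdvd.
- by move=> g; apply/val_inj; rewrite /= morphX ?inE // expg_exponent // subgP.
have nilS : nilpotent [set: subg_of G].
  by rewrite -(isog_nil (isog_subg G)); apply: pgroup_nil pG.
(* For class [c] the trivial term is ['L_(c.+1)], since ['L_1] is the whole group; hence the need
   for [c < p ^ n]. *)
have /(lcn_nil_classP _ nilS) := leqnn (nil_class [set: subg_of G]).
rewrite -(isog_nil_class (isog_subg G)) => L1; apply/trivgP; rewrite -L1.
by apply: lcn_sub_leq; apply: leq_expn_up_log; rewrite // odd_prime_gt2.
Qed.
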